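(* Assume the standing assumption and suppose $d(HD)=m+1$. Then the only feasible solution of $(P)$ is $x=0$, and $(D)$ is strictly feasible (has a positive definite feasible solution). Consequently $\operatorname{val}(P)=\operatorname{val}(D)=0$.
   Context: $(P)$: $\sup\{c^Tx:\sum_{i=1}^mx_iA_i\preceq B\}$, $(D)$: $\inf\{B\bullet Y:A_i\bullet Y=c_i\ \forall i,\ Y\succeq0\}$, $(HD)$: $\{Y\succeq0: A_i\bullet Y=0\ (i=1,\dots,m),\ B\bullet Y=0\}$, with $A_i,B\in\mathcal S^n$, $c\in\mathbb R^m$, $S\bullet T=\operatorname{trace}(ST)$. Standing assumption: $(P)$ is feasible, $A_1,\dots,A_m,B$ are linearly independent, $B=I_r\oplus0$ with $0\le r<n$, and $B$ is a maximum-rank slack $B-\sum_ix_iA_i\succeq0$ of $(P)$. Singularity degree $d(H\cap K)$ (for closed convex cone $K$, affine subspace $H$ with $H\cap K\neq\emptyset$): least $k$ such that there are $y_i\in F_{i-1}^*\cap H^\perp$ with $F_0=K$, $F_i=F_{i-1}\cap y_i^\perp$ and $F_k$ equal to the smallest face of $K$ containing $H\cap K$; $K^*=\{y:\langle y,x\rangle\ge0\ \forall x\in K\}$, $H^\perp=\{y:\langle y,x\rangle=0\ \forall x\in H\}$. $d(HD)$ is the singularity degree of the feasible set of $(HD)$ (with $K=\mathcal S^n_+$). *)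

(* Defs.v *)
From HB Require Import structures.
From mathcomp Require Import all_boot all_order all_algebra.
Set Implicit Arguments. Unset Strict Implicit. Unset Printing Implicit Defensive.
Import Order.TTheory GRing.Theory Num.Theory.
Local Open Scope ring_scope.

Section SDP.
Variable R : rcfType.
Variable n : nat.

Definition sym (X : 'M[R]_n) : Prop := X^T = X.

Definition frob (X Y : 'M[R]_n) : R := \tr (X *m Y).

Definition psd (X : 'M[R]_n) : Prop :=
  sym X /\ forall v : 'cV[R]_n, 0 <= (v^T *m X *m v) 0 0.
Definition pd (X : 'M[R]_n) : Prop :=
  sym X /\ forall v : 'cV[R]_n, v != 0 -> 0 < (v^T *m X *m v) 0 0.

Definition mset := 'M[R]_n -> Prop.

Definition dual (K : mset) : mset :=
  fun Y => sym Y /\ forall X, K X -> 0 <= frob Y X.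

Definition perp (H : mset) : mset :=
  fun Y => sym Y /\ forall X, H X -> frob Y X = 0.

Definition convex (C : mset) : Prop :=
  forall X Y t, C X -> C Y -> 0 <= t -> t <= 1 -> C (t *: X + (1 - t) *: Y).

Definition face (K F : mset) : Prop :=
  (forall X, F X -> K X) /\ convex F /\
  (forall X Y t, K X -> K Y -> 0 < t -> t < 1 ->
     F (t *: X + (1 - t) *: Y) -> F X /\ F Y).

Definition minimal_face (K S F : mset) : Prop :=
  face K F /\ (forall X, S X -> F X) /\
  (forall G, face K G -> (forall X, S X -> G X) -> forall X, F X -> G X).

(* F_i = F_{i-1} \cap y_i^perp with F_0 = K, where y_{j+1} is written y j *)
Definition Fseq (K : mset) (y : nat -> 'M[R]_n) (i : nat) : mset :=
  fun X => K X /\ forall j, (j < i)%N -> frob (y j) X = 0.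

Definition fr_sequence (K H : mset) (k : nat) : Prop :=
  exists y : nat -> 'M[R]_n,
    (forall j, (j < k)%N -> dual (Fseq K y j) (y j) /\ perp H (y j)) /\
    exists Fmin, minimal_face K (fun X => H X /\ K X) Fmin /\
      forall X, Fseq K y k X <-> Fmin X.

Definition sing_degree (K H : mset) (d : nat) : Prop :=
  fr_sequence K H d /\ forall k, (k < d)%N -> ~ fr_sequence K H k.

End SDP.

Definition is_sup (R : rcfType) (S : R -> Prop) (s : R) : Prop :=
  (forall v, S v -> v <= s) /\ (forall u, (forall v, S v -> v <= u) -> s <= u).
Definition is_inf (R : rcfType) (S : R -> Prop) (s : R) : Prop :=
  (forall v, S v -> s <= v) /\ (forall u, (forall v, S v -> u <= v) -> u <= s).

Section Problems.
Variables (R : rcfType) (n m : nat) (A : 'I_m -> 'M[R]_n) (B : 'M[R]_n) (c : 'cV[R]_m).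

Definition slack (x : 'cV[R]_m) : 'M[R]_n := B - \sum_(i < m) x i 0 *: A i.
Definition feasP (x : 'cV[R]_m) : Prop := psd (slack x).
Definition objP (x : 'cV[R]_m) : R := (c^T *m x) 0 0.
Definition feasD (Y : 'M[R]_n) : Prop :=
  (forall i, frob (A i) Y = c i 0) /\ psd Y.
(* feasible set of (HD) as intersection H \cap K *)
Definition HD_H : mset R n :=
  fun Y => sym Y /\ (forall i, frob (A i) Y = 0) /\ frob B Y = 0.

Definition valP_is (v : R) : Prop := is_sup (fun t => exists x, feasP x /\ t = objP x) v.
Definition valD_is (v : R) : Prop := is_inf (fun t => exists Y, feasD Y /\ t = frob B Y) v.

Definition standing (r : nat) : Prop :=
  (forall i, sym (A i)) /\
  (exists x, feasP x) /\
  (forall (a : 'I_m -> R) (b : R),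
      \sum_(i < m) a i *: A i + b *: B = 0 -> (forall i, a i = 0) /\ b = 0) /\
  (r < n)%N /\ B = pid_mx r /\
  (* B = slack 0 is a maximum-rank slack of (P) *)
  (forall x, feasP x -> (\rank (slack x) <= \rank B)%N).
End Problems.

(* Main.v *)
(* Let L be the span of A_1, .., A_m, B, of dimension m + 1.  A psd matrix of L that is not a
   multiple of B could be inserted after B in a facial reduction sequence for (HD); as the
   members of such a sequence lie in L, one of them would then be redundant, and d(HD) would
   be at most m.  So the psd matrices of L are the multiples of B, which by linear
   independence leaves x = 0 as the only feasible point of (P).  For every v > 0, no nonzero
   combination of the matrices A_i - (c_i / v) B is psd, so by Stiemke's alternative a
   positive definite Y is orthogonal to all of them; rescaled, it is feasible for (D) with
   value v.

   Over a real closed field there is no compactness argument for Stiemke's alternative.  It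
   is proved by lowering the number of matrices one at a time: among the combinations of two
   of them, one is found that can replace both, from the fact (quantifier elimination) that
   the line is definably connected. *)
Require Import Defs.
From HB Require Import structures.
From mathcomp Require Import all_boot all_order all_algebra.
From mathcomp Require Import polyrcf ordered_qelim.
From mathcomp Require qe_rcf.
From mathcomp Require Import ring lra.
Import Order.TTheory GRing.Theory Num.Theory.
Local Open Scope ring_scope.
Set Implicit Arguments. Unset Strict Implicit. Unset Printing Implicit Defensive.

(** * Definable subsets of a real closed field *)

Section Definable.
Variable R : rcfType.
Implicit Types (e : seq R) (P : seq R -> Prop) (g : seq R -> R).

Definition polyfun g := exists t : GRing.term R, forall e, GRing.eval e t = g e.
Definition definable P := exists f : ord.formula R, forall e, ord.holds e f <-> P e.

Lemma polyfun_const c : polyfun (fun _ => c).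
Proof. by exists (GRing.Const c). Qed.

Lemma polyfun_var i : polyfun (fun e => e`_i).
Proof. by exists (GRing.Var R i). Qed.

Lemma polyfunD g h : polyfun g -> polyfun h -> polyfun (fun e => g e + h e).
Proof. by move=> [t tE] [u uE]; exists (GRing.Add t u) => e /=; rewrite tE uE. Qed.

Lemma polyfunM g h : polyfun g -> polyfun h -> polyfun (fun e => g e * h e).
Proof. by move=> [t tE] [u uE]; exists (GRing.Mul t u) => e /=; rewrite tE uE. Qed.

Lemma polyfun_eq g h : (forall e, g e = h e) -> polyfun g -> polyfun h.
Proof. by move=> gh [t tE]; exists t => e; rewrite tE. Qed.

Lemma polyfun_sum (I : finType) (F : I -> seq R -> R) :
  (forall i, polyfun (F i)) -> polyfun (fun e => \sum_i F i e).
Proof.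
move=> FP; elim: (index_enum I) => [|i s IHs].
  by apply: polyfun_eq (polyfun_const 0) => e; rewrite big_nil.
by apply: polyfun_eq (polyfunD (FP i) IHs) => e; rewrite big_cons.
Qed.

Lemma definable_iff P Q : (forall e, P e <-> Q e) -> definable P -> definable Q.
Proof. by move=> PQ [f fP]; exists f => e; apply: (iff_trans (fP e)). Qed.

Lemma definable_eq0 g : polyfun g -> definable (fun e => g e = 0).
Proof.
by move=> [t tE]; exists (ord.Equal t (GRing.NatConst R 0)) => e /=; rewrite tE.
Qed.

Lemma definable_gt0 g : polyfun g -> definable (fun e => 0 < g e).
Proof. by move=> [t tE]; exists (ord.Lt (GRing.NatConst R 0) t) => e /=; rewrite tE. Qed.

Lemma definable_ge0 g : polyfun g -> definable (fun e => 0 <= g e).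
Proof. by move=> [t tE]; exists (ord.Le (GRing.NatConst R 0) t) => e /=; rewrite tE. Qed.

Lemma definable_and P Q : definable P -> definable Q -> definable (fun e => P e /\ Q e).
Proof.
by move=> [f fP] [h hP]; exists (ord.And f h) => e /=; move: (fP e) (hP e); tauto.
Qed.

Lemma definable_not P : definable P -> definable (fun e => ~ P e).
Proof. by move=> [f fP]; exists (ord.Not f) => e /=; move: (fP e); tauto. Qed.

Lemma definable_all (I : finType) (F : I -> seq R -> Prop) :
  (forall i, definable (F i)) -> definable (fun e => forall i, F i e).
Proof.
move=> FP; suff : definable (fun e => forall i, i \in enum I -> F i e).
  by apply: definable_iff => e; split=> H i *; apply: H; rewrite ?mem_enum.
elim: (enum I) => [|i s IHs].
  by apply: definable_iff (definable_eq0 (polyfun_const 0)) => e; split.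
apply: definable_iff (definable_and (FP i) IHs) => e; split.
  by move=> [Fi Fs] j; rewrite inE => /predU1P[->|/Fs].
by move=> Fs; split=> [|j js]; apply: Fs; rewrite inE ?eqxx ?js ?orbT.
Qed.

(** Quantifier elimination decides every formula, so excluded middle holds for definable statements;
    the case splits of [avoid_plane] rely on this. *)
Lemma definable_dec P e : definable P -> P e \/ ~ P e.
Proof.
by move=> [f fP]; case: (qe_rcf.rcf_satP e f) => H; [left|right]; rewrite -fP.
Qed.

Lemma definable_env P e e' : definable P ->
  (forall j, e`_j = e'`_j) -> P e -> P e'.
Proof. by move=> [f fP] ee'; rewrite -!fP; apply: ord.eq_holds. Qed.

(** A whole block of [k] variables starting at [a] is quantified at once: the witness is an
    environment that agrees with [e] outside the block. *)
Lemma definable_exists a k P : definable P ->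
  definable (fun e => exists e', (forall j, ~~ (a <= j < a + k)%N -> e'`_j = e`_j) /\ P e').
Proof.
elim: k P => [|k IHk] P Pdef.
  apply: (definable_iff _ (Pdef)) => e; split=> [Pe|[e' [ee' Pe']]]; first by exists e.
  apply: (definable_env Pdef) Pe' => j.
  by rewrite ee' // addn0; case: ltnP; rewrite ?andbF // => ->.
have [f fP] := IHk _ Pdef; exists (ord.Exists (a + k) f) => e; split.
  move=> [x /fP [e' [ee' Pe']]]; exists e'; split=> // j.
  rewrite addnS => jP; rewrite ee'; last by apply: contra jP; case/andP=> -> /leqW.
  rewrite nth_set_nth /=; case: eqP => // jE; case/negP: jP.
  by rewrite jE leq_addr ltnSn.
move=> [e' [ee' Pe']]; exists e'`_(a + k); apply/fP; exists e'; split=> // j jP.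
rewrite nth_set_nth /=; case: eqP => [->//|/eqP jNk]; rewrite ee' //.
by apply: contra jP; rewrite addnS ltnS (leq_eqVlt j) (negPf jNk).
Qed.

Lemma definable_forall a k P : definable P ->
  definable (fun e => forall e', (forall j, ~~ (a <= j < a + k)%N -> e'`_j = e`_j) -> P e').
Proof.
move=> Pdef; have := definable_not (definable_exists a k (definable_not Pdef)).
apply: definable_iff => e; split=> [H e' ee'|H [e' [/H]]] //.
by case: (definable_dec e' Pdef) => // NP; case: H; exists e'.
Qed.

(** The exceptional points are the roots: an interval free of them keeps the sign, by the
    intermediate value theorem. The zero polynomial has no finite list of roots, but its sign is
    constant. *)
Lemma poly_sign_constant_off (p : {poly R}) : exists s : seq R, forall u v, u <= v ->
  (forall z, z \in s -> ~~ (u <= z <= v)) -> Num.sg p.[u] = Num.sg p.[v].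
Proof.
have [->|p0] := eqVneq p 0; first by exists [::] => u v *; rewrite !horner0.
exists (rootsR p) => u v uv noroot.
apply: (@polyrN0_itv _ `[u, v]).
- move=> z; rewrite in_itv /= => zuv; apply/negP => rz; have := noroot z.
  by rewrite -(roots_on_rootsR p0) inE /= rz zuv; move/(_ isT).
- by rewrite in_itv /= lexx uv.
- by rewrite in_itv /= lexx uv.
Qed.

(** Each atom depends only on the sign of one polynomial, and a binary connective merely
    concatenates the lists of exceptional points. *)
Lemma qf_constant_off (f : ord.formula R) : ord.qf_form f && ord.rformula f ->
  exists s : seq R, forall u v, u <= v -> (forall z, z \in s -> ~~ (u <= z <= v)) ->
    ord.qf_eval [:: u] f = ord.qf_eval [:: v] f.
Proof.
have sgP (t : GRing.term R) : GRing.rterm t ->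
    exists p : {poly R}, forall u, p.[u] = GRing.eval [:: u] t.
  (* The entry of [[:: 0]] is a placeholder, overwritten by the point [u] of evaluation. *)
  move=> tr; exists (qe_rcf.eval_poly [:: 0] (qe_rcf.abstrX 0 (qe_rcf.to_rterm t))) => u.
  by rewrite qe_rcf.abstrXP qe_rcf.evalE qe_rcf.to_rtermE.
have atom (F : R -> bool) (g : R -> bool) (t1 t2 : GRing.term R) :
    GRing.rterm t1 && GRing.rterm t2 ->
    (forall u, F u = g (Num.sg (GRing.eval [:: u] t1 - GRing.eval [:: u] t2))) ->
    exists s : seq R, forall u v, u <= v -> (forall z, z \in s -> ~~ (u <= z <= v)) -> F u = F v.
  move=> /andP[/sgP[p pE] /sgP[q qE]] FE.
  have [s sP] := poly_sign_constant_off (p - q).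
  by exists s => u v uv /(sP _ _ uv); rewrite !FE -!pE -!qE !hornerE => ->.
have binary (F G : R -> bool) (h : bool -> bool -> bool) :
    (exists s : seq R, forall u v, u <= v -> (forall z, z \in s -> ~~ (u <= z <= v)) -> F u = F v) ->
    (exists s : seq R, forall u v, u <= v -> (forall z, z \in s -> ~~ (u <= z <= v)) -> G u = G v) ->
    exists s : seq R, forall u v, u <= v -> (forall z, z \in s -> ~~ (u <= z <= v)) ->
      h (F u) (G u) = h (F v) (G v).
  move=> [s sF] [s' sG]; exists (s ++ s') => u v uv ss'.
  by rewrite (sF u v) ?(sG u v) // => z zs; apply: ss'; rewrite mem_cat zs ?orbT.
elim: f => //=.
- by move=> b _; exists [::].
- move=> t1 t2 r12; apply: (@atom (fun u => GRing.eval [:: u] t1 == GRing.eval [:: u] t2) (fun x => x == 0) t1 t2 r12) => u.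
  by rewrite sgr_eq0 subr_eq0.
- move=> t1 t2 r12; apply: (@atom (fun u => GRing.eval [:: u] t1 < GRing.eval [:: u] t2) (fun x => x < 0) t1 t2 r12) => u.
  by rewrite sgr_lt0 subr_lt0.
- move=> t1 t2 r12; apply: (@atom (fun u => GRing.eval [:: u] t1 <= GRing.eval [:: u] t2) (fun x => x <= 0) t1 t2 r12) => u.
  by rewrite sgr_le0 subr_le0.
- by move=> f IHf g IHg /andP[/andP[qf qg] /andP[rf rg]];
    apply: (binary _ _ andb); [apply: IHf|apply: IHg]; apply/andP.
- by move=> f IHf g IHg /andP[/andP[qf qg] /andP[rf rg]];
    apply: (binary _ _ orb); [apply: IHf|apply: IHg]; apply/andP.
- by move=> f IHf g IHg /andP[/andP[qf qg] /andP[rf rg]];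
    apply: (binary _ _ implb); [apply: IHf|apply: IHg]; apply/andP.
- by move=> f IHf /IHf [s sP]; exists s => u v uv /(sP _ _ uv) ->.
Qed.

Lemma definable_constant_off P : definable P ->
  exists s : seq R, forall u v, u <= v -> (forall z, z \in s -> ~~ (u <= z <= v)) ->
    P [:: u] <-> P [:: v].
Proof.
move=> [f fP].
have wf := ord.quantifier_elim_wf (@qe_rcf.wf_QE_wproj R) (ord.to_rform_rformula f).
have [s sP] := qf_constant_off wf; exists s => u v uv /(sP _ _ uv) uvE.
by rewrite -!fP !(rwP (qe_rcf.rcf_satP _ _)) /qe_rcf.rcf_sat /ord.proj_sat uvE.
Qed.

(* A neighbourhood of each of the finitely many exceptional points is crossed by
   local constancy. *)
Lemma locally_constant_off (s : seq R) (P : R -> Prop) x y : x <= y ->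
  (forall u v, x <= u -> u <= v -> v <= y -> (forall z, z \in s -> ~~ (u <= z <= v)) ->
     P u <-> P v) ->
  (forall p, exists2 eps, 0 < eps & forall t, `|t - p| <= eps -> P t <-> P p) ->
  P x <-> P y.
Proof.
elim: s x y => [|p s IHs] x y xy off loc; first by apply: off.
(* An interval that misses [p] has only the points of [s] to avoid, so the induction hypothesis
   covers it. *)
have step u v : x <= u -> u <= v -> v <= y -> ~~ (u <= p <= v) -> P u <-> P v.
  move=> xu uv vy puv; apply: IHs => // u' v' uu' u'v' v'v off'.
  apply: off; rewrite ?(le_trans xu) ?(le_trans v'v) // => z.
  rewrite inE => /predU1P[->|/off'//]; apply: contra puv.
  by case/andP=> /(le_trans uu') -> /le_trans ->.
have [pxy|] := boolP (x <= p <= y); last by apply: step.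
have [xp py] := andP pxy; have [eps eps0 epsP] := loc p.
have near t : t = p - eps \/ t = p + eps -> P t <-> P p.
  by case=> ->; apply: epsP; rewrite addrAC subrr add0r ?normrN gtr0_norm.
(* Either [x] is already within [eps] of [p], or [p - eps] serves as a relay; the right side is
   symmetric. *)
have left_ : P x <-> P p.
  have [px|px] := lerP (p - x) eps.
    by apply: epsP; rewrite distrC ger0_norm ?subr_ge0.
  have H : P x <-> P (p - eps).
    by apply: step; try lra; apply/negP => /andP[_]; lra.
  by apply: (iff_trans H); apply: near; left.
have right_ : P p <-> P y.
  have [px|px] := lerP (y - p) eps.
    by apply: iff_sym; apply: epsP; rewrite ger0_norm ?subr_ge0.
  have H : P (p + eps) <-> P y.
    by apply: step; try lra; apply/negP => /andP[? _]; lra.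
  by apply: iff_trans H; apply: iff_sym; apply: near; right.
exact: iff_trans left_ right_.
Qed.

(** Local constancy alone would not do: infinitesimals form a clopen set in a non-archimedean field.
    Definability leaves finitely many points to cross. *)
Lemma definable_connected P : definable P ->
  (forall p, exists2 eps, 0 < eps & forall t, `|t - p| <= eps -> P [:: t] <-> P [:: p]) ->
  forall x y, P [:: x] <-> P [:: y].
Proof.
move=> /definable_constant_off [s sP] loc x y; wlog xy : x y / x <= y => [H|].
  by have [/H//|/ltW/H] := lerP x y; apply: iff_sym.
exact: (@locally_constant_off s (fun t => P [:: t]) x y xy (fun u v _ uv _ => sP u v uv)).
Qed.

End Definable.

(** * Positive semidefinite matrices *)

Section Frobenius.
Variables (R : rcfType) (n : nat).
Implicit Types (X Y Z : 'M[R]_n) (v : 'cV[R]_n).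

Lemma frobE X Y : frob X Y = \sum_i \sum_j X i j * Y j i.
Proof. by apply: eq_bigr => i _; rewrite mxE. Qed.

Lemma frobDl X Y Z : frob (X + Y) Z = frob X Z + frob Y Z.
Proof. by rewrite /frob mulmxDl mxtraceD. Qed.

Lemma frobZl a X Y : frob (a *: X) Y = a * frob X Y.
Proof. by rewrite /frob -scalemxAl mxtraceZ. Qed.

Lemma frobDr X Y Z : frob X (Y + Z) = frob X Y + frob X Z.
Proof. by rewrite /frob mulmxDr mxtraceD. Qed.

Lemma frobZr a X Y : frob X (a *: Y) = a * frob X Y.
Proof. by rewrite /frob -scalemxAr mxtraceZ. Qed.

Lemma frob0l X : frob 0 X = 0.
Proof. by rewrite /frob mul0mx mxtrace0. Qed.

Lemma quadE X v : (v^T *m X *m v) 0 0 = \sum_i \sum_j v i 0 * X i j * v j 0.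
Proof.
rewrite exchange_big mxE; apply: eq_bigr => j _; rewrite mxE mulr_suml.
by apply: eq_bigr => i _; rewrite mxE.
Qed.

Lemma quad_frob X v : (v^T *m X *m v) 0 0 = frob X (v *m v^T).
Proof. by rewrite /frob mulmxA mxtrace_mulC mulmxA -trace_mx11. Qed.

Lemma quad_scalar a v : (v^T *m a%:M *m v) 0 0 = a * (v^T *m v) 0 0.
Proof. by rewrite mul_mx_scalar -scalemxAl mxE. Qed.

Lemma sqnorm_ge0 v : 0 <= (v^T *m v) 0 0.
Proof. by rewrite mxE sumr_ge0 // => i _; rewrite mxE -expr2 sqr_ge0. Qed.

Lemma sqnorm_eq0 v : ((v^T *m v) 0 0 == 0) = (v == 0).
Proof.
apply/eqP/eqP => [|->]; last by rewrite mulmx0 mxE.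
rewrite mxE => H; have {}H : \sum_i v i 0 ^+ 2 = 0.
  by rewrite -[RHS]H; apply: eq_bigr => i _; rewrite mxE expr2.
apply/colP => i; rewrite mxE; apply/eqP; rewrite -sqrf_eq0; apply/eqP.
by apply: (psumr_eq0P _ H) => // j _; apply: sqr_ge0.
Qed.

Lemma symD X Y : sym X -> sym Y -> sym (X + Y).
Proof. by rewrite /sym raddfD /= => -> ->. Qed.

Lemma symZ a X : sym X -> sym (a *: X).
Proof. by rewrite /sym linearZ /= => ->. Qed.

Lemma sym_scalar a : sym (a%:M : 'M[R]_n).
Proof. exact: tr_scalar_mx. Qed.

Lemma psdD X Y : psd X -> psd Y -> psd (X + Y).
Proof.
move=> [Xs Xp] [Ys Yp]; split=> [|v]; first exact: symD.
by rewrite mulmxDr mulmxDl mxE addr_ge0.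
Qed.

Lemma psdZ a X : 0 <= a -> psd X -> psd (a *: X).
Proof.
move=> a0 [Xs Xp]; split=> [|v]; first exact: symZ.
by rewrite -scalemxAr -scalemxAl mxE mulr_ge0.
Qed.

Lemma psd_scalar a : 0 <= a -> psd (a%:M : 'M[R]_n).
Proof.
by move=> a0; split=> [|v]; rewrite ?quad_scalar ?mulr_ge0 ?sqnorm_ge0 //; apply: sym_scalar.
Qed.

Lemma psd_outer v : psd (v *m v^T).
Proof.
split=> [|w]; first by rewrite /sym trmx_mul trmxK.
rewrite mulmxA -mulmxA -[v^T *m w]trmxK trmx_mul trmxK.
by rewrite mxE big_ord1 [X in _ * X]mxE -expr2 sqr_ge0.
Qed.

(* Positive definiteness with an explicit margin: without compactness, openness is immediate
   only in this form. *)
Definition upd Y := exists2 eps, 0 < eps & psd (Y - eps%:M).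

Lemma upd_sym Y : upd Y -> sym Y.
Proof.
by move=> [eps _ [Ys _]]; rewrite -(subrK eps%:M Y); apply: symD Ys (sym_scalar _).
Qed.

Lemma upd_pd Y : upd Y -> pd Y.
Proof.
move=> Yu; split=> [|v v0]; first exact: upd_sym.
have [eps eps0 [_ /(_ v)]] := Yu.
rewrite mulmxBr mulmxBl mxE [X in _ + X]mxE quad_scalar subr_ge0; apply: lt_le_trans.
by rewrite mulr_gt0 // lt_def sqnorm_ge0 sqnorm_eq0 v0.
Qed.

Lemma pd_psd Y : pd Y -> psd Y.
Proof.
move=> [Ys Yp]; split=> // v; have [->|/Yp/ltW//] := eqVneq v 0.
by rewrite mulmx0 mxE.
Qed.

Lemma upd_add_psd Y X : upd Y -> psd X -> upd (Y + X).
Proof. by move=> [eps eps0 Yp] Xp; exists eps; rewrite // addrAC; apply: psdD. Qed.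

Lemma updD X Y : upd X -> upd Y -> upd (X + Y).
Proof. by move=> Xu /upd_pd/pd_psd; apply: upd_add_psd. Qed.

Lemma updZ a Y : 0 < a -> upd Y -> upd (a *: Y).
Proof.
move=> a0 [eps eps0 Yp]; exists (a * eps); first exact: mulr_gt0.
by rewrite -scale_scalar_mx -scalerBr; apply: psdZ Yp; apply: ltW.
Qed.

Lemma upd_scalar a : 0 < a -> upd (a%:M : 'M[R]_n).
Proof. by move=> a0; exists a; rewrite // subrr -(scale0r 1%:M) scale_scalar_mx mul0r; apply: psd_scalar. Qed.

(** A crude substitute for the operator norm: the square of |v_i| - |v_j| being nonnegative, |v_i|
    |v_j| is at most v^T v. *)
Lemma quad_bound X v :
  `|(v^T *m X *m v) 0 0| <= (\sum_i \sum_j `|X i j|) * (v^T *m v) 0 0.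
Proof.
have sq_le i : v i 0 ^+ 2 <= (v^T *m v) 0 0.
  rewrite mxE (bigD1 i) //= mxE -expr2 lerDl sumr_ge0 // => j _.
  by rewrite mxE -expr2 sqr_ge0.
rewrite quadE mulr_suml; apply: (le_trans (ler_norm_sum _ _ _)).
apply: ler_sum => i _; rewrite mulr_suml; apply: (le_trans (ler_norm_sum _ _ _)).
apply: ler_sum => j _; rewrite !normrM mulrAC mulrC ler_wpM2l //.
have := sq_le i; have := sq_le j; rewrite -!(real_normK (num_real (v _ 0))).
have := sqr_ge0 (`|v i 0| - `|v j 0|); nra.
Qed.

(** Half of the margin of [Y] absorbs the perturbation and the other half remains. The summand 1 in
    [M] keeps the divisor positive. *)
Lemma upd_open Y Z : upd Y -> sym Z ->
  exists2 del, 0 < del & forall s, `|s| <= del -> upd (Y + s *: Z).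
Proof.
move=> [eps eps0 [Ys Yp]] Zs; pose M := 1 + \sum_i \sum_j `|Z i j|.
have M0 : 0 < M by rewrite ltr_wpDr // sumr_ge0 // => i _; rewrite sumr_ge0.
have MP v : `|(v^T *m Z *m v) 0 0| <= M * (v^T *m v) 0 0.
  by apply: le_trans (quad_bound Z v) _; rewrite ler_wpM2r ?sqnorm_ge0 // lerDr.
exists (eps / 2 / M) => [|s sd]; first by rewrite !divr_gt0.
exists (eps / 2); first by rewrite divr_gt0.
have -> : Y + s *: Z - (eps / 2)%:M = (Y - eps%:M) + (s *: Z + (eps / 2)%:M).
  rewrite {2}(splitr eps) raddfD /= opprD addrA -!addrA; congr (_ + _).
  by rewrite [X in _ = _ + X]addrC addrK addrC.
apply: psdD => //; split=> [|v]; first by apply: symD (symZ _ Zs) (sym_scalar _).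
rewrite mulmxDr mulmxDl mxE quad_scalar -scalemxAr -scalemxAl [X in X + _]mxE.
suff : `|s * (v^T *m Z *m v) 0 0| <= eps / 2 * (v^T *m v) 0 0.
  by rewrite ler_norml => /andP[]; rewrite -subr_ge0 opprK.
rewrite normrM; apply: (le_trans (ler_pM _ _ sd (MP v))) => //.
by rewrite mulrA divfK // gt_eqF.
Qed.

(** The rank-one test matrices are not definite, so they are shifted by [eps%:M], with [eps] small
    enough for a negative value to stay negative. *)
Lemma psd_of_upd Z : sym Z -> (forall Y, upd Y -> 0 <= frob Z Y) -> psd Z.
Proof.
move=> Zs Zp; split=> // v; rewrite quad_frob leNgt; apply/negP => neg.
pose a := frob Z 1%:M; pose b := frob Z (v *m v^T); pose eps := - b / (`|a| + 1).
have a1 : 0 < `|a| + 1 by rewrite ltr_wpDl.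
have eps0 : 0 < eps by rewrite divr_gt0 // oppr_gt0.
have := Zp _ (upd_add_psd (upd_scalar eps0) (psd_outer v)).
rewrite -[eps%:M]scalemx1 frobDr frobZr -/a -/b leNgt; case/negP.
have : eps * (`|a| + 1) = - b by rewrite /eps divfK // gt_eqF.
by have := ler_norm a; nra.
Qed.

End Frobenius.

(** * Stiemke's alternative *)

Section DefinableUpd.
Variables (R : rcfType) (n : nat).
Implicit Types (e : seq R) (Y : 'M[R]_n).

Lemma overwrite_env e a k (f : 'I_k -> R) : exists e',
  (forall j, ~~ (a <= j < a + k)%N -> e'`_j = e`_j) /\ (forall i : 'I_k, e'`_(a + i) = f i).
Proof.
pose g j := if (a <= j)%N then oapp f e`_j (insub (j - a)%N) else e`_j.
(* This length covers both [e] and the block; beyond it both lists read the default 0. *)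
exists (mkseq g (size e + (a + k))); split=> [j jP|i]; last first.
  rewrite nth_mkseq; last by rewrite (leq_trans _ (leq_addl _ _)) // ltn_add2l.
  by rewrite /g leq_addr addKn valK.
have gj : g j = e`_j.
  rewrite /g; case: leqP => // aj; rewrite insubF //.
  by apply: contraNF jP => jk; rewrite aj -ltn_subLR.
have [je|je] := ltnP j (size e + (a + k)); first by rewrite nth_mkseq.
by rewrite !nth_default ?size_mkseq // (leq_trans (leq_addr _ _) je).
Qed.

(* Environments list a scalar parameter, the margin eps of [upd], the entries of a
   matrix, and the coordinates of a test vector. *)
Definition env_mx e : 'M[R]_n := \matrix_(i, j) e`_(2 + mxvec_index i j).

Lemma definable_psd_env : definable (fun e => psd (env_mx e - (e`_1)%:M)).
Proof.
pose a := (2 + n * n)%N.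
pose entry e (i j : 'I_n) := e`_(2 + mxvec_index i j) + - e`_1 * (i == j)%:R.
have entryP i j : polyfun (fun e => entry e i j).
  apply: polyfunD (polyfun_var _ _) (polyfunM _ (polyfun_const _)).
  apply: polyfun_eq (polyfunM (polyfun_const (-1)) (polyfun_var _ 1%N)) => e.
  by rewrite mulN1r.
have symP : definable (fun e => forall i j, entry e i j + (-1) * entry e j i = 0).
  apply: definable_all => i; apply: definable_all => j; apply: definable_eq0.
  by apply: polyfunD => //; apply: polyfunM => //; apply: polyfun_const.
have quadP : definable (fun e => 0 <= \sum_(i < n) \sum_(j < n) e`_(a + i) * entry e i j * e`_(a + j)).
  apply: definable_ge0; apply: polyfun_sum => i; apply: polyfun_sum => j.
  by apply: polyfunM (polyfunM _ _) _ => //; apply: polyfun_var.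
have entryE e i j : (env_mx e - (e`_1)%:M) i j = entry e i j.
  by rewrite !mxE /entry mulNr mulr_natr.
apply: definable_iff (definable_and symP (definable_forall a n quadP)) => e.
split=> [[symE posE]|[symE posE]]; split.
- by apply/matrixP => i j; rewrite mxE !entryE; have := symE i j; lra.
- move=> v; have [e' [ee' e'v]] := overwrite_env e a (fun i => v i 0).
  have := posE e' ee'; congr (_ <= _); rewrite quadE.
  apply: eq_bigr => i _; apply: eq_bigr => j _; rewrite !e'v entryE /entry.
  by rewrite !ee' // negb_and -ltnNge ?ltn_add2l ?ltn_ord.
- by move=> i j; rewrite -!entryE -{1}symE mxE mulN1r subrr.
- move=> e' ee'; have := posE (\col_i e'`_(a + i)); congr (_ <= _); rewrite quadE.
  apply: eq_bigr => i _; apply: eq_bigr => j _; rewrite !mxE -entryE !mxE.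
  have below k : (k < a)%N -> e'`_k = e`_k by move=> ka; rewrite ee' // negb_and -ltnNge ka.
  by rewrite (below 1%N) ?(below (2 + mxvec_index i j)%N) ?ltn_add2l.
Qed.

(** The quantified block consists of index 1, the margin, and the [n * n] matrix entries; index 0
    stays free as the scalar parameter. *)
Lemma definable_upd (P : R -> 'M[R]_n -> Prop) :
  definable (fun e => P e`_0 (env_mx e)) ->
  definable (fun e => exists2 Y, upd Y & P e`_0 Y).
Proof.
move=> Pdef; have epsP := definable_gt0 (polyfun_var R 1).
have := definable_exists 1 (1 + n * n)
  (definable_and epsP (definable_and definable_psd_env Pdef)).
apply: definable_iff => e; split=> [[e' [ee' [eps0 [Yp PY]]]]|[Y [eps eps0 Yp] PY]].
  by exists (env_mx e'); rewrite -?ee' //; exists e'`_1.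
(* [unlift ord0] separates the margin, first in the block, from the entries. *)
have [e' [ee' e'Y]] := overwrite_env e 1
  (fun i : 'I_(1 + n * n) => oapp (mxvec Y 0) eps (unlift ord0 i)).
have e'1 : e'`_1 = eps by have := e'Y ord0; rewrite unlift_none.
have e'mx : env_mx e' = Y.
  apply/matrixP => i j; rewrite mxE -[RHS]mxvecE.
  by have := e'Y (lift ord0 (mxvec_index i j)); rewrite liftK.
by exists e'; rewrite e'1 e'mx ee'.
Qed.

Lemma polyfun_frob (X : 'M[R]_n) : polyfun (fun e => frob X (env_mx e)).
Proof.
have : polyfun (fun e => \sum_i \sum_j X i j * e`_(2 + mxvec_index j i)).
  apply: polyfun_sum => i; apply: polyfun_sum => j.
  by apply: polyfunM (polyfun_const _) (polyfun_var _ _).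
apply: polyfun_eq => e; rewrite frobE; apply: eq_bigr => i _.
by apply: eq_bigr => j _; rewrite mxE.
Qed.

End DefinableUpd.

Section Stiemke.
Variables (R : rcfType) (n : nat).
Implicit Types (X Y Z : 'M[R]_n).

Section Plane.
Variables (m : nat) (C : 'I_m -> 'M[R]_n) (A0 A1 : 'M[R]_n).

Let Q Y := forall i, frob (C i) Y = 0.

Let QD Y Z : Q Y -> Q Z -> Q (Y + Z).
Proof. by move=> QY QZ i; rewrite frobDr QY QZ addr0. Qed.

Let QZ a Y : Q Y -> Q (a *: Y).
Proof. by move=> QY i; rewrite frobZr QY mulr0. Qed.

Let definableQ : definable (fun e => Q (env_mx n e)).
Proof. by apply: definable_all => i; apply: definable_eq0; apply: polyfun_frob. Qed.

(** The values of (A0, A1) at [Y] lie on the line A0 = t A1, so slopes are measured as A0 over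
    A1. *)
Let zero_at (t : R) Y := frob A0 Y + - t * frob A1 Y = 0.

Let definable_zero : definable (fun e => zero_at e`_0 (env_mx n e)).
Proof.
apply: definable_eq0; apply: polyfunD (polyfun_frob A0) (polyfunM _ (polyfun_frob A1)).
apply: polyfun_eq (polyfunM (polyfun_const (-1)) (polyfun_var _ 0)) => e.
by rewrite mulN1r.
Qed.

(** With [s] equal to 1 or -1, the cone of values meets the half of the line of slope [t] on which
    A1 has the sign of [s]. *)
Let positive_at (s t : R) := exists2 Y, upd Y & [/\ Q Y, zero_at t Y & 0 < s * frob A1 Y].

Let definable_positive s : definable (fun e => positive_at s e`_0).
Proof.
apply: (@definable_upd R n (fun t Y => [/\ Q Y, zero_at t Y & 0 < s * frob A1 Y])).
have sP := definable_gt0 (polyfunM (polyfun_const s) (polyfun_frob A1)).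
apply: definable_iff (definable_and definableQ (definable_and definable_zero sP)) => e.
by split=> [[? []]|[]].
Qed.

(* The line spanned by (-b, a) in the plane of values of (A0, A1) misses the open convex
   cone of those values, unless that cone is the whole plane.  The slope t of such a line is
   found by connectedness: otherwise the slopes met in the half-plane A1 > 0 and
   those met in A1 < 0 would partition R into two nonempty open sets. *)
Lemma avoid_plane :
  (exists2 Y, upd Y & [/\ Q Y, frob A0 Y = 0 & frob A1 Y = 0]) \/
  exists a b, (a != 0 \/ b != 0) /\
    forall Y, upd Y -> Q Y -> a * frob A0 Y + b * frob A1 Y != 0.
Proof.
have dec (P : 'M[R]_n -> Prop) : definable (fun e => P (env_mx n e)) ->
    (exists2 Y, upd Y & P Y) \/ forall Y, upd Y -> ~ P Y.
  move=> /(@definable_upd R n (fun _ => P)) /(definable_dec [::]).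
  by case=> H; [left|right=> Y Yu PY; apply: H; exists Y].
have def0 X : definable (fun e => frob X (env_mx n e) = 0).
  by apply: definable_eq0; apply: polyfun_frob.
have [[Y Yu [QY [Y0 Y1]]]|no] :=
  dec (fun Y => Q Y /\ frob A0 Y = 0 /\ frob A1 Y = 0)
      (definable_and definableQ (definable_and (def0 A0) (def0 A1))).
  by left; exists Y.
right; have [[Y0 Y0u [QY0 Y01]]|noA1] :=
  dec (fun Y => Q Y /\ frob A1 Y = 0) (definable_and definableQ (def0 A1)); last first.
  exists 0, 1; split=> [|Y Yu QY]; first by right; apply: oner_neq0.
  by rewrite mul0r add0r mul1r; apply/eqP => AY; apply: (noA1 Y).
pose hit t := exists2 Y, upd Y & Q Y /\ zero_at t Y.
have definable_hit : definable (fun e => hit e`_0).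
  by apply: (@definable_upd R n (fun t Y => Q Y /\ zero_at t Y)); apply: definable_and.
(* Whether some slope is missed is decidable; if t is missed, A0 - t A1 has no zero on the cone. *)
have := definable_dec [::] (definable_exists 0 1 (definable_not definable_hit)).
case=> [[e [_ Ne]]|all_hit].
  exists 1, (- e`_0); split=> [|Y Yu QY]; first by left; apply: oner_neq0.
  by apply/eqP; rewrite mul1r => H; apply: Ne; exists Y.
have {}all_hit t : hit t.
  have [//|Nt] := definable_dec [:: t] definable_hit; case: all_hit.
  by exists [:: t]; split=> // -[|j] //=; rewrite nth_nil.
have QY0a : frob A0 Y0 != 0 by apply/eqP => Y00; apply: (no Y0).
have split_hit t : positive_at 1 t \/ positive_at (-1) t.
  have [Y Yu [QY zY]] := all_hit t; have [H|H|H] := ltrgt0P (frob A1 Y).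
  - by left; exists Y => //; rewrite mul1r; split.
  - by right; exists Y => //; rewrite mulN1r oppr_gt0; split.
  - by case: (no Y) => //; move: zY; rewrite /zero_at H mulr0 addr0.
(* Points on opposite halves of one line have a positive combination at the origin, which [no]
   excludes. *)
have disj t : positive_at 1 t -> positive_at (-1) t -> False.
  move=> [Y Yu [QY zY pY]] [Z Zu [QZ' zZ pZ]].
  rewrite mul1r in pY; rewrite mulN1r in pZ.
  apply: (no (frob A1 Y *: Z + (- frob A1 Z) *: Y)).
    by apply: updD; apply: updZ.
  split; first by apply: QD; apply: QZ.
  by move: zY zZ; rewrite /zero_at !frobDr !frobZr; split; nra.
(* Adding a multiple of [Y0] changes A0 but not A1; the multiple [r] turns the slope from [p] to
   [t]. *)
have open s p : positive_at s p ->
    exists2 eps, 0 < eps & forall t, `|t - p| <= eps -> positive_at s t.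
  move=> [Y Yu [QY zY pY]].
  have [del del0 delP] := upd_open Yu (upd_sym Y0u).
  have Y1n0 : frob A1 Y != 0 by apply: contraTneq pY => ->; rewrite mulr0 ltxx.
  have c0 : 0 < `|frob A1 Y / frob A0 Y0| by rewrite normr_gt0 mulf_neq0 ?invr_eq0.
  exists (del / `|frob A1 Y / frob A0 Y0|) => [|t tp]; first exact: divr_gt0.
  pose r := (t - p) * (frob A1 Y / frob A0 Y0).
  exists (Y + r *: Y0); first by apply: delP; rewrite normrM -ler_pdivlMr.
  split; first by apply: QD => //; apply: QZ.
    rewrite /zero_at !frobDr !frobZr Y01 /r mulr0 addr0.
    have -> : frob A0 Y = p * frob A1 Y by move: zY; rewrite /zero_at; lra.
    by field.
  by rewrite frobDr frobZr Y01 mulr0 addr0.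
(* Since A1 vanishes at [Y0], subtracting a little of [Y] from [Y0] gives A1 the opposite sign; the
   new slope is then read off. *)
have flip s t : positive_at s t -> exists t', positive_at (- s) t'.
  move=> [Y Yu [QY zY pY]].
  have [del del0 delP] := upd_open Y0u (upd_sym Yu).
  have Y1n0 : frob A1 Y != 0 by apply: contraTneq pY => ->; rewrite mulr0 ltxx.
  exists ((frob A0 Y0 - del * frob A0 Y) / (- del * frob A1 Y)).
  exists (Y0 + (- del) *: Y); first by apply: delP; rewrite normrN gtr0_norm.
  rewrite /zero_at !frobDr !frobZr Y01; split; first by apply: QD => //; apply: QZ.
    by field; rewrite Y1n0 gt_eqF.
  have -> : - s * (0 + - del * frob A1 Y) = del * (s * frob A1 Y) by ring.
  exact: mulr_gt0.
have [p [q [pp pq]]] : exists p q, positive_at 1 p /\ positive_at (-1) q.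
  have [H|H] := split_hit 0; first by have [q Hq] := flip _ _ H; exists 0, q.
  by have [q Hq] := flip _ _ H; exists q, 0; rewrite opprK in Hq.
have conn := definable_connected (definable_positive 1).
(* The set [positive_at 1] is open, and its complement is the open set [positive_at (-1)]; by
   connectedness it would contain [q] along with [p]. *)
case: (disj q) => //; apply/(conn _ p q) => // x.
have [/open[eps eps0 epsP]|H] := split_hit x.
  by exists eps => // t tx; split=> _; apply: epsP; rewrite // subrr normr0 ltW.
have [eps eps0 epsP] := open _ _ H; exists eps => // t tx.
by split=> H'; [case: (disj t); last exact: epsP | case: (disj x)].
Qed.

End Plane.

(** In the induction step, the combination from [avoid_plane] replaces the first two matrices. No
    definite [Y] is orthogonal to the shorter family, so the induction hypothesis gives a psd
    combination of it; this expands to one of the longer family, nontrivial because [a] or [b] is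
    nonzero. *)
Lemma stiemke m (A : 'I_m -> 'M[R]_n) : (forall i, sym (A i)) ->
  (exists2 Y, upd Y & forall i, frob (A i) Y = 0) \/
  (exists x : 'I_m -> R, (exists i, x i != 0) /\ psd (\sum_i x i *: A i)).
Proof.
elim: m A => [|[|m] IHm] A As.
- by left; exists 1%:M; [exact: upd_scalar|case].
(* A single matrix is paired with the zero matrix, under no constraints. *)
- have [[Y Yu [_ AY _]]|[a [b [ab H]]]] := avoid_plane (fun i : 'I_0 => 0) (A 0) 0.
    by left; exists Y => // i; rewrite ord1.
  have AN0 Y : upd Y -> frob (A 0) Y != 0.
    move=> /H /(_ (fun i => match i with Ordinal _ p => False_ind _ (notF p) end)).
    by rewrite frob0l mulr0 addr0; apply: contraNneq => ->; rewrite mulr0.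
  right; pose s := frob (A 0) 1%:M; have s0 : s != 0 by apply: AN0; apply: upd_scalar.
  exists (fun=> s); split; first by exists 0.
  rewrite big_ord1; apply: psd_of_upd => [|Y Yu]; first exact: symZ.
  (* If the matrix had opposite signs at the identity and at [Y], it would vanish at a positive
     combination of the two. *)
  rewrite frobZl leNgt; apply/negP => neg.
  have : upd (- (s * frob (A 0) Y) *: 1%:M + (s * s) *: Y).
    apply: updD; apply: updZ => //; first by rewrite oppr_gt0.
      exact: upd_scalar.
    by rewrite -expr2 lt_def sqr_ge0 sqrf_eq0 s0.
  by move/AN0; rewrite frobDr !frobZr -/s; case/eqP; ring.
pose C (i : 'I_m) := A (lift ord0 (lift ord0 i)).
pose i1 : 'I_m.+2 := lift ord0 ord0.
have splitA (P : 'I_m.+2 -> Prop) :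
    P ord0 -> P i1 -> (forall i : 'I_m, P (lift ord0 (lift ord0 i))) -> forall i, P i.
  move=> P0 P1 P2 i; case: (unliftP ord0 i) => [j ->|->//].
  by case: (unliftP ord0 j) => [k ->|->].
have [[Y Yu [QY Y0 Y1]]|[a [b [ab H]]]] := avoid_plane C (A ord0) (A i1).
  by left; exists Y => //; apply: splitA.
pose A' (i : 'I_m.+1) := oapp C (a *: A ord0 + b *: A i1) (unlift ord0 i).
have A'0 : A' ord0 = a *: A ord0 + b *: A i1 by rewrite /A' unlift_none.
have A'S i : A' (lift ord0 i) = C i by rewrite /A' liftK.
have A's i : sym (A' i).
  case: (unliftP ord0 i) => [j|] ->; rewrite ?A'S ?A'0; first exact: As.
  by apply: symD; apply: symZ.
have [[Y Yu YA]|[x [[i xi] xp]]] := IHm A' A's.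
  have /eqP[] : a * frob (A ord0) Y + b * frob (A i1) Y != 0.
    by apply: H => // j; rewrite -A'S.
  by have := YA ord0; rewrite A'0 frobDl !frobZl.
right; exists (fun i => if unlift ord0 i is Some j then
                 (if unlift ord0 j is Some k then x (lift ord0 k) else x ord0 * b)
               else x ord0 * a); split; last first.
  rewrite big_ord_recl A'0 scalerDr !scalerA -addrA in xp; move: xp.
  rewrite 2!big_ord_recl unlift_none liftK unlift_none.
  congr (psd (_ + (_ + _))); apply: eq_bigr => k _.
  by rewrite A'S !liftK.
case: (unliftP ord0 i) xi => [j ->|->] xi.
  by exists (lift ord0 (lift ord0 j)); rewrite !liftK.
case: ab => ab; last by exists i1; rewrite liftK unlift_none mulf_neq0.
by exists ord0; rewrite unlift_none mulf_neq0.
Qed.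

End Stiemke.

(** * Facial reduction *)

(** Otherwise each term would raise the rank by at least one, and [k] terms would reach rank [k]. *)
Lemma dependent_term (F : fieldType) (N : nat) (w : nat -> 'rV[F]_N) k :
  (\rank (\sum_(i < k) <<w i>>)%MS < k)%N ->
  exists2 j, (j < k)%N & (w j <= \sum_(i < j) <<w i>>)%MS.
Proof.
elim: k => // k IHk; have [wk _|wk] := boolP (w k <= \sum_(i < k) <<w i>>)%MS.
  by exists k.
rewrite big_ord_recr /= => rk; case: IHk => [|j jk wj]; last by exists j; rewrite // leqW.
rewrite -ltnS; apply: leq_trans rk; rewrite ltnS; apply: rank_ltmx.
rewrite ltmxE addsmxSl /=; apply: contra wk; apply: submx_trans.
by apply: submx_trans (addsmxSr _ _); rewrite genmxE.
Qed.

Section PsdEntries.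
Variables (R : rcfType) (n : nat).
Implicit Types (X C : 'M[R]_n).

Lemma psd_diag_ge0 X i : psd X -> 0 <= X i i.
Proof. by move=> [_ /(_ (delta_mx i 0))]; rewrite trmx_delta -rowE -colE !mxE. Qed.

Lemma psd_diag0 X i j : psd X -> X i i = 0 -> X i j = 0.
Proof.
move=> [Xs Xp] Xii; apply/eqP; apply: contraT => Xij.
have Xji : X j i = X i j by rewrite -{1}Xs mxE.
(* As [X i i] is 0, the form at t e_i + e_j is 2 t X_ij + X_jj, and this [t] makes it -1. *)
pose t := - (X j j + 1) / (2 * X i j).
have := Xp (t *: delta_mx i 0 + delta_mx j 0).
rewrite [(_ + _)^T]raddfD /= [(_ *: _)^T]linearZ /= !trmx_delta mulmxDr !mulmxDl.
rewrite -!scalemxAr -!scalemxAl -!rowE -!colE !mxE Xii Xji.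
have -> : t * (t * 0) + t * X i j + (t * X i j + X j j) = -1 :> R by rewrite /t; field.
by rewrite oppr_ge0 ler10.
Qed.

Lemma frob_pid r X : frob (pid_mx r) X = \sum_(i < n | (i < r)%N) X i i.
Proof.
rewrite frobE [RHS]big_mkcond; apply: eq_bigr => i _ /=; rewrite (bigD1 i) //= mxE eqxx /=.
rewrite big1 => [|j ji]; last by rewrite mxE (inj_eq val_inj) eq_sym (negPf ji) mul0r.
by case: ifP; rewrite ?mul1r ?mul0r addr0.
Qed.

Lemma frob_pid_ge0 r X : psd X -> 0 <= frob (pid_mx r) X.
Proof. by move=> Xp; rewrite frob_pid sumr_ge0 // => i _; apply: psd_diag_ge0. Qed.

Lemma sym_pid r : sym (pid_mx r : 'M[R]_n).
Proof. exact: tr_pid_mx. Qed.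

Lemma psd_pid r : psd (pid_mx r : 'M[R]_n).
Proof.
split=> [|v]; first exact: sym_pid.
by rewrite quad_frob; apply/frob_pid_ge0/psd_outer.
Qed.

Lemma frob_pid_eq0 r X (i : 'I_n) : psd X -> frob (pid_mx r) X = 0 -> (i < r)%N -> X i i = 0.
Proof.
move=> Xp; rewrite frob_pid => X0 ir.
by apply: (psumr_eq0P _ X0) => // j _; apply: psd_diag_ge0.
Qed.

Lemma frob_mxvec (X C : 'M[R]_n) : (mxvec X *m (mxvec C)^T) 0 0 = frob X C^T.
Proof.
rewrite mxE (reindex _ (curry_mxvec_bij _ _)) /= frobE pair_bigA /=.
by apply: eq_bigr => -[i j] _ /=; rewrite !mxE !mxvecE.
Qed.

(* Maximality of the rank makes the kernel of pid_mx r + t C contain that of pid_mx r, so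
   C is supported on the leading r x r block. *)
Lemma frob_max_rank r C X t : psd C -> 0 < t ->
  (\rank ((pid_mx r + t *: C)%R) <= \rank (pid_mx r : 'M[R]_n))%N ->
  psd X -> frob (pid_mx r) X = 0 -> frob C X = 0.
Proof.
move=> Cp t0 rk Xp X0; have [Ps Pp] := psd_pid r; have [Cs Cq] := Cp.
have ker_sub : (kermx (pid_mx r + t *: C)%R <= kermx (pid_mx r : 'M[R]_n))%MS.
  apply/rV_subP => u /sub_kermxP uS; apply/sub_kermxP.
  have /eqP : (u *m (pid_mx r + t *: C) *m u^T) 0 0 = 0 by rewrite uS mul0mx mxE.
  rewrite mulmxDr mulmxDl mxE -scalemxAr -scalemxAl [X in _ + X]mxE.
  have := Pp u^T; have := Cq u^T; rewrite trmxK => uC uP.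
  rewrite paddr_eq0 ?(mulr_ge0 (ltW t0)) // => /andP[/eqP uP0 _].
  have {}uP0 : frob (pid_mx r) (u^T *m u) = 0 by rewrite -[u in X in _ *m X]trmxK -quad_frob trmxK.
  have up : psd (u^T *m u) by rewrite -{2}[u]trmxK; apply: psd_outer.
  apply/rowP => j; rewrite mxE [RHS]mxE big1 // => i _; rewrite mxE.
  have [ij|] := eqVneq; last by rewrite mulr0.
  have [ir|] := boolP (i < r)%N; last by rewrite mulr0.
  have /eqP := frob_pid_eq0 up uP0 ir; rewrite mxE big_ord1 mxE -expr2 sqrf_eq0.
  by move=> /eqP ->; rewrite mul0r.
(* The rank bound makes the kernel of the sum at least as large, so the inclusion is an equality. *)
have ker_eq : (kermx (pid_mx r : 'M[R]_n) <= kermx (pid_mx r + t *: C)%R)%MS.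
  rewrite -(geq_leqif (mxrank_leqif_sup ker_sub)) !mxrank_ker.
  exact: leq_sub2l.
have C0 (i j : 'I_n) : (r <= i)%N -> C i j = 0.
  move=> ri; apply: (psd_diag0 j Cp).
  have Pi0 : (delta_mx 0 i : 'rV[R]_n) *m (pid_mx r : 'M[R]_n) = 0.
    by rewrite -rowE; apply/rowP => k; rewrite !mxE [(i < r)%N]ltnNge ri andbF.
  have /sub_kermxP : ((delta_mx 0 i : 'rV[R]_n) <= kermx (pid_mx r + t *: C)%R)%MS.
    by apply: submx_trans ker_eq; apply/sub_kermxP.
  rewrite mulmxDr Pi0 add0r -rowE => /rowP /(_ i) /eqP; rewrite !mxE.
  by rewrite mulf_eq0 gt_eqF // => /eqP.
rewrite frobE big1 // => i _; rewrite big1 // => j _.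
have [ir|ri] := ltnP i r; last by rewrite C0 // mul0r.
have -> : X j i = X i j by have [Xs _] := Xp; rewrite -{1}Xs mxE.
by rewrite (psd_diag0 _ Xp) ?mulr0 // (frob_pid_eq0 Xp X0).
Qed.

End PsdEntries.

Section Span.
Variables (R : rcfType) (n m : nat) (A : 'I_m -> 'M[R]_n) (B : 'M[R]_n).

(** The row space is the span L in vectorised form: membership becomes [<=] of row spaces, and the
    number of rows bounds the dimension by [m + 1]. *)
Definition span_mx : 'M[R]_(m + 1, n * n) := col_mx (\matrix_i mxvec (A i)) (mxvec B).

Lemma span_mxP C : (mxvec C <= span_mx)%MS ->
  exists (a : 'I_m -> R) (b : R), C = \sum_i a i *: A i + b *: B.
Proof.
case/submxP => D; rewrite -[D]hsubmxK mul_row_col mulmx_sum_row => CE.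
exists (fun i => lsubmx D 0 i), (rsubmx D 0 0); apply: (can_inj mxvecK); rewrite CE.
rewrite linearD linear_sum linearZ /= [rsubmx D]mx11_scalar mul_scalar_mx mxE.
by congr (_ + _); [apply: eq_bigr => i _; rewrite rowK linearZ | rewrite mxE].
Qed.

Lemma span_mxA i : (mxvec (A i) <= span_mx)%MS.
Proof.
by rewrite -addsmxE; apply: submx_trans (addsmxSl _ _); rewrite -(rowK (fun i => mxvec (A i))) row_sub.
Qed.

Lemma span_mxB : (mxvec B <= span_mx)%MS.
Proof. by rewrite -addsmxE addsmxSr. Qed.

Lemma span_mx_comb (a : 'I_m -> R) b : (mxvec (\sum_i a i *: A i + b *: B) <= span_mx)%MS.
Proof.
rewrite linearD linear_sum linearZ /= addmx_sub ?scalemx_sub ?span_mxB //.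
by apply: summx_sub => i _; rewrite linearZ scalemx_sub ?span_mxA.
Qed.

(** The double orthogonal of L is L. A column [z] of the cokernel annihilates L; symmetrising it
    gives a point of [HD_H], and against symmetric matrices this only doubles the product. *)
Lemma perp_span y : (forall i, sym (A i)) -> sym B -> perp (HD_H A B) y ->
  (mxvec y <= span_mx)%MS.
Proof.
move=> As Bs [ys yH]; rewrite submxE; apply/eqP/rowP => k; rewrite [RHS]mxE.
pose z := col k (cokermx span_mx); pose X : 'M[R]_n := vec_mx z^T.
have dot C : sym C -> (mxvec C *m z) 0 0 = frob C X.
  move=> Cs; rewrite -[z]trmxK -[z^T]vec_mxK frob_mxvec /frob.
  by rewrite -mxtrace_tr trmx_mul trmxK Cs mxtrace_mulC.
have dot2 C : sym C -> frob C (X + X^T) = 2 * (mxvec C *m z) 0 0.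
  move=> Cs; rewrite dot // frobDr; suff -> : frob C X^T = frob C X by ring.
  by rewrite /frob -mxtrace_tr trmx_mul trmxK Cs mxtrace_mulC.
have span0 C : (mxvec C <= span_mx)%MS -> (mxvec C *m z) 0 0 = 0.
  by rewrite submxE => /eqP C0; rewrite /z colE mulmxA C0 mul0mx mxE.
have : frob y (X + X^T) = 0.
  apply: yH; split; first by rewrite /sym raddfD /= trmxK addrC.
  by split=> [i|]; rewrite dot2 ?span0 ?mulr0 ?span_mxA ?span_mxB.
rewrite dot2 // => /eqP; rewrite mulf_eq0 pnatr_eq0 /= => /eqP.
by rewrite /z colE mulmxA -colE mxE.
Qed.

End Span.

(** The matrices orthogonal to [X] form the kernel of a linear form, which contains a sum of lines
    once it contains each line. *)
Lemma frob_sums_sub (R : rcfType) n (W : nat -> 'M[R]_n) k (Z X : 'M[R]_n) :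
  (mxvec Z <= \sum_(i < k) <<mxvec (W i)>>)%MS ->
  (forall i, (i < k)%N -> frob (W i) X = 0) -> frob Z X = 0.
Proof.
move=> ZW WX; have kerP Y : (mxvec Y <= kermx (mxvec X^T)^T)%MS <-> frob Y X = 0.
  split=> [/sub_kermxP YX|YX]; last first.
    by apply/sub_kermxP/rowP => i; rewrite ord1 frob_mxvec trmxK YX mxE.
  by have := frob_mxvec Y X^T; rewrite trmxK YX mxE.
apply/kerP/(submx_trans ZW)/sumsmx_subP => i _; rewrite genmxE.
by apply/kerP/WX.
Qed.

Section FacialReduction.
Variables (R : rcfType) (n : nat).
Implicit Types (X Y : 'M[R]_n).

Lemma dual_psd_psd Y : dual (@psd R n) Y -> psd Y.
Proof.
by move=> [Ys Yp]; split=> // v; rewrite quad_frob; apply/Yp/psd_outer.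
Qed.

(** An exposed face: a nonnegative form that vanishes at an interior point of a segment vanishes at
    both ends. It contains the feasible set of (HD), hence also the minimal face. *)
Lemma face_pid_perp r : face (@psd R n) (fun X => psd X /\ frob (pid_mx r) X = 0).
Proof.
split; first by move=> X [].
split=> [X Y t [Xp X0] [Yp Y0] t0 t1|X Y t Xp Yp t0 t1 [_]].
  rewrite frobDr !frobZr X0 Y0 !mulr0 addr0; split=> //.
  by apply: psdD; apply: psdZ; rewrite ?subr_ge0.
have t1' : 0 < 1 - t by rewrite subr_gt0.
rewrite frobDr !frobZr => /eqP.
rewrite paddr_eq0 ?mulr_ge0 ?frob_pid_ge0 ?(ltW t0) ?(ltW t1') // !mulf_eq0.
by rewrite (gt_eqF t0) (gt_eqF t1') => /andP[/eqP ? /eqP ?].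
Qed.

End FacialReduction.

(** * Singularity degree m + 1 under the standing assumption *)

Section Standing.
Variables (R : rcfType) (n m r : nat) (A : 'I_m -> 'M[R]_n) (B : 'M[R]_n).
Hypothesis st : standing A B r.

Lemma standing_free (a : 'I_m -> R) b :
  \sum_i a i *: A i + b *: B = 0 -> (forall i, a i = 0) /\ b = 0.
Proof. by case: st => _ [_ [free _]]; apply: free. Qed.

Lemma standing_neq0 : B != 0.
Proof.
apply/eqP => B0; have [|_ /eqP] := @standing_free (fun=> 0) 1; last by rewrite oner_eq0.
by rewrite B0 scaler0 addr0 big1 // => i _; rewrite scale0r.
Qed.

(** For small [t], [B + t *: C] is a positive multiple of a slack, so the maximality of the rank of
    [B] applies to it. *)
Lemma standing_perp C X : psd C -> (mxvec C <= span_mx A B)%MS ->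
  psd X -> frob B X = 0 -> frob C X = 0.
Proof.
move=> Cp /span_mxP[a [b CE]]; have [_ [_ [_ [_ [BE rk]]]]] := st.
(* This [t] keeps [u], the total coefficient of [B] in [B + t *: C], positive. *)
pose t := (1 + `|b|)^-1; have b1 : 0 < 1 + `|b| by rewrite ltr_pwDl.
have t0 : 0 < t by rewrite invr_gt0.
pose u := 1 + t * b; have u0 : 0 < u.
  have -> : u = (1 + `|b| + b) * t by rewrite /u /t; field; rewrite gt_eqF.
  by rewrite mulr_gt0 //; have := lerNnormlW (lexx `|b|); lra.
pose x : 'cV[R]_m := \col_i (- (t * a i) / u).
have xE : slack A B x = u^-1 *: (B + t *: C).
  rewrite CE (_ : B + _ = u *: B + t *: \sum_i a i *: A i); last first.
    by rewrite scalerDl scale1r scalerDr scalerA [in LHS]addrA addrAC.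
  rewrite scalerDr scalerA mulVf ?gt_eqF // scale1r /slack; congr (_ + _).
  rewrite -sumrN !scaler_sumr; apply: eq_bigr => i _.
  rewrite mxE !scalerA -scaleNr; congr (_ *: _).
  by field; rewrite gt_eqF.
have Bp : psd B by rewrite BE; apply: psd_pid.
have xp : feasP A B x.
  by rewrite /feasP xE; apply: psdZ; [rewrite invr_ge0 ltW|apply: psdD => //; apply: psdZ => //; apply: ltW].
have := rk x xp; rewrite xE mxrank_scale_nz ?invr_eq0 ?gt_eqF // BE.
by move=> {}rk; apply: frob_max_rank rk.
Qed.

(* If C were not a multiple of B, then among B, C, y 1, .., y m, which number m + 2 in a
   space of dimension m + 1, some y k would depend on its predecessors.  Replacing y 0 by B
   and dropping y k would leave a facial reduction sequence of length m. *)
Lemma psd_span_multiple C : sing_degree (@psd R n) (HD_H A B) m.+1 ->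
  psd C -> (mxvec C <= span_mx A B)%MS -> exists b, C = b *: B.
Proof.
move=> [[y [yP [Fmin [[Fface [HF Fleast]] FP]]]] short] Cp CAB.
have [As [_ [_ [_ [BE _]]]]] := st.
have Bs : sym B by rewrite BE; apply: sym_pid.
have ysub j : (j < m.+1)%N -> (mxvec (y j) <= span_mx A B)%MS.
  by move=> /yP[_ yH]; apply: perp_span.
have [/sub_rVP[b CB]|CNB] := boolP (mxvec C <= mxvec B)%MS.
  by exists b; apply: (can_inj mxvecK); rewrite CB linearZ.
case: (short m (ltnSn m)).
(* The terms are B, C, y 1, .., y m. The dependent one is neither B, which is nonzero, nor C, by
   [CNB], so it is [W k.+2], that is [y k.+1]. *)
pose W i := if i is j.+1 then (if j is _.+1 then y j else C) else B.
have [[|[|k]] jm Wj] : exists2 j, (j < m.+2)%N &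
    (mxvec (W j) <= \sum_(i < j) <<mxvec (W i)>>)%MS.
- apply: dependent_term; rewrite ltnS.
  have : (\sum_(i < m.+2) <<mxvec (W i)>> <= span_mx A B)%MS.
    apply/sumsmx_subP => -[[|[|i]] im] _; rewrite genmxE //=; first exact: span_mxB.
    exact: ysub.
  move/mxrankS/leq_trans; apply; rewrite -[m.+1]addn1; exact: rank_leq_row.
- move: Wj; rewrite big_ord0 submx0 => /eqP B0; case/eqP: standing_neq0.
  by apply: (can_inj mxvecK); rewrite B0 linear0.
- by move: Wj; rewrite big_ord1 genmxE (negPf CNB).
have km : (k < m)%N by rewrite -2!ltnS.
have y0p : psd (y 0).
  by apply: dual_psd_psd; have [[ys yd] _] := yP 0 isT; split=> // X Xp; apply: yd.
pose y' i := if i is 0 then B else if (i <= k)%N then y i else y i.+1.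
(* Each new face lies in the old one of the same index, and in the next one once the dropped term is
   passed. Orthogonality to [y 0] and [C] follows from that to [B], and orthogonality to [y k.+1]
   from its dependence. *)
have y'y i X l : (0 < i)%N -> Fseq (@psd R n) y' i X -> (l < i + (k < i))%N ->
    frob (y l) X = 0.
  move=> i0 [Xp Xy'] li; have BX : frob B X = 0 by apply: (Xy' 0).
  have below l' : (l' < i)%N -> (l' <= k)%N -> frob (y l') X = 0.
    case: l' => [_ _|l' l'i l'k]; first by apply: (standing_perp y0p) => //; apply: ysub.
    by have := Xy' l'.+1 l'i; rewrite /= l'k.
  have [lk|kl] := leqP l k.
    by apply: below => //; have [ki|] := boolP (k < i)%N; [apply: leq_ltn_trans ki|move: li; case: (k < i)%N; rewrite /= ?addn0].
  have ki : (k < i)%N by case: (ltnP k i) li => // ik; rewrite addn0 ltnNge (leq_trans ik (ltnW kl)).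
  have [lE|lNk] := eqVneq l k.+1.
    rewrite lE; apply: (frob_sums_sub Wj) => -[|[|j]] //= jk.
      exact: (standing_perp Cp).
    by apply: below; rewrite // (leq_ltn_trans _ ki).
  case: l li kl lNk => // l; rewrite ki addn1 ltnS eqSS => li kl lNk.
  have {lNk}kl : (k < l)%N by rewrite ltn_neqAle eq_sym lNk.
  by have := Xy' l li; rewrite /y'; case: l kl {li} => // l kl; rewrite [(l.+1 <= k)%N]leqNgt kl.
exists y'; split=> [i im|].
  case: i im => [|i] im.
    split; split=> // X; last by case=> _ [].
    by move=> [Xp _]; rewrite [y' 0]BE; apply: frob_pid_ge0.
  (* Duals grow as faces shrink, so the old vectors stay admissible. *)
  have shrink l : (l < m.+1)%N -> (l <= i.+1 + (k < i.+1))%N ->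
      dual (Fseq (@psd R n) y' i.+1) (y l) /\ perp (HD_H A B) (y l).
    move=> /yP[[ys yd] yH] li; split=> //; split=> // X XF; apply: yd.
    split=> [|l' l'l]; first by case: XF.
    by apply: (y'y i.+1) => //; apply: leq_trans l'l li.
  rewrite /y'; case: (leqP i.+1 k) => ik; apply: shrink => //; last by rewrite ik addn1.
    exact: leqW.
  exact: leq_addr.
exists Fmin; split=> // X; rewrite -FP; split=> [XF|XF].
  split=> [|l lm]; first by case: XF.
  by apply: (y'y m) => //; [apply: leq_ltn_trans km|rewrite km addn1].
(* Conversely, the minimal face lies in the face cut out by [B], so the new first vector vanishes on
   it as well. *)
have BX : frob B X = 0.
  have [] // : psd X /\ frob B X = 0.
  rewrite BE; apply: (Fleast _ (@face_pid_perp R n r)); last by apply/FP.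
  by move=> Z [[_ [_ BZ]] Zp]; rewrite -BE.
have [Xp Xy] := XF; split=> // -[|l] lm //=.
by case: ifP => _; apply: Xy => //; apply: leqW.
Qed.

End Standing.

(** * Feasible points and values of (P) and (D) *)

Section Conclusion.
Variables (R : rcfType) (n m r : nat) (A : 'I_m -> 'M[R]_n) (B : 'M[R]_n) (c : 'cV[R]_m).
Hypotheses (st : standing A B r) (sd : sing_degree (@psd R n) (HD_H A B) m.+1).

(** As [B] is nonzero, [r] is positive, and a zero product would annul the first diagonal entry of
    [Y]. *)
Lemma frob_pd_gt0 Y : pd Y -> 0 < frob B Y.
Proof.
move=> Yp; have [_ [_ [_ [rn [BE _]]]]] := st.
have r0 : (0 < r)%N.
  by case: (posnP r) BE (standing_neq0 st) => // -> ->; rewrite pid_mx_0 eqxx.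
rewrite lt_def {2}BE frob_pid_ge0 ?andbT; last exact: pd_psd.
apply/eqP => BY; pose i : 'I_n := Ordinal (ltn_trans r0 rn).
have Yii : Y i i = 0 by apply: (frob_pid_eq0 (r := r) (pd_psd Yp)) => //; rewrite -BE.
have [_ /(_ (delta_mx i 0))] := Yp; rewrite trmx_delta -rowE -colE !mxE Yii ltxx.
have d0 : delta_mx i 0 != 0 :> 'cV[R]_n.
  by apply/eqP => /colP/(_ i)/eqP; rewrite !mxE !eqxx oner_eq0.
by move/(_ d0).
Qed.

Lemma feasP_eq0 x : feasP A B x -> x = 0.
Proof.
move=> xp; have [|b xE] := psd_span_multiple st sd xp.
  have := span_mx_comb A B (fun i => - x i 0) 1; rewrite scale1r addrC.
  by congr (mxvec (_ + _) <= _)%MS; rewrite -sumrN; apply: eq_bigr => i _; rewrite scaleNr.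
have [|x0 _] := @standing_free _ _ _ _ _ _ st (fun i => x i 0) (b - 1).
  by rewrite scalerBl scale1r -xE /slack [B - _]addrC addrK subrr.
by apply/colP => i; rewrite x0 mxE.
Qed.

(* Stiemke's alternative applied to the matrices A i - (c i / v) B: a positive definite Y
   orthogonal to all of them is feasible for (D) with value v after rescaling. *)
Lemma feasD_pd_val v : 0 < v -> exists Y, [/\ feasD A c Y, pd Y & frob B Y = v].
Proof.
move=> v0; have [As [_ [_ [_ [BE _]]]]] := st.
have Bs : sym B by rewrite BE; apply: sym_pid.
have [i||] := @stiemke R n m (fun i => A i + (- (c i 0 / v)) *: B).
- by apply: symD => //; apply: symZ.
- move=> [Y Yu AY]; have BY := frob_pd_gt0 (upd_pd Yu).
  pose t := v / frob B Y; have t0 : 0 < t by rewrite divr_gt0.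
  have tYp : pd (t *: Y) by apply/upd_pd/updZ.
  exists (t *: Y); split=> //; last by rewrite frobZr divfK ?gt_eqF.
  split=> [i|]; last exact: pd_psd.
  have := AY i; rewrite frobDl frobZl frobZr => AYi.
  have -> : frob (A i) Y = c i 0 / v * frob B Y by lra.
  by rewrite /t; field; rewrite !gt_eqF.
(* The other alternative gives a psd matrix of L, hence a multiple of [B]; independence then forces
   every [x i] to vanish. *)
move=> [x [[i xi] xp]]; case/eqP: xi.
have xE : \sum_i x i *: (A i + (- (c i 0 / v)) *: B) =
    \sum_i x i *: A i + (\sum_i x i * - (c i 0 / v)) *: B.
  by rewrite scaler_suml -big_split; apply: eq_bigr => j _; rewrite scalerDr scalerA.
rewrite xE in xp; have [b bE] := psd_span_multiple st sd xp (span_mx_comb _ _ _ _).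
have [|-> //] := @standing_free _ _ _ _ _ _ st x ((\sum_i x i * - (c i 0 / v)) - b).
by rewrite scalerBl addrA bE subrr.
Qed.

End Conclusion.

Theorem theorem4 (R : rcfType) (n m r : nat) (A : 'I_m -> 'M[R]_n)
    (B : 'M[R]_n) (c : 'cV[R]_m) :
  standing A B r ->
  sing_degree (@psd R n) (HD_H A B) m.+1 ->
  (forall x, feasP A B x -> x = 0) /\
  (exists Y, feasD A c Y /\ pd Y) /\
  valP_is A B c 0 /\ valD_is A B c 0.
Proof.
move=> st sd; have Px0 := feasP_eq0 st sd; have [_ [_ [_ [_ [BE _]]]]] := st.
split=> //; split.
  by have [Y [YD Yp _]] := feasD_pd_val c st sd ltr01; exists Y.
split; split=> [t|u uP].
- by move=> [x [/Px0 -> ->]]; rewrite /objP mulmx0 mxE.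
- apply: uP; exists 0; rewrite /objP mulmx0 mxE; split=> //.
  rewrite /feasP /slack big1 => [|i _]; last by rewrite mxE scale0r.
  by rewrite subr0 BE; apply: psd_pid.
- by move=> [Y [[_ Yp] ->]]; rewrite BE; apply: frob_pid_ge0.
(* A positive lower bound [u] is refuted by a feasible point of value [u / 2]. *)
rewrite leNgt; apply/negP => u0; have u2 : 0 < u / 2 by rewrite divr_gt0.
have [Y [YD _ BY]] := feasD_pd_val c st sd u2.
have uu : u <= u / 2 by apply: uP; exists Y.
by move: uu u0; clear; lra.
Qed.
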